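(* Let $T$ be a tree of order $n$. Then $\sigma_1(T)\ge n-1$, with equality if and only if $T\cong K_{1,n-1}$.
   Context: Graphs are finite, simple and undirected, with at least one vertex; the order of a graph is its number of vertices. For a graph $G$, $\sigma_1(G)$ denotes the number of $1$-nearly independent vertex subsets of $G$, i.e. the number of subsets $I$ of the vertex set $V(G)$ such that the subgraph of $G$ induced by $I$ has exactly one edge. $K_{1,n-1}$ is the star on $n$ vertices: one central vertex adjacent to each of $n-1$ pairwise nonadjacent other vertices (for $n=1$ this is read as the one-vertex graph $K_1$). *)

(* Defs.v *)
From mathcomp Require Import all_boot.
Set Implicit Arguments.
Unset Strict Implicit.
Unset Printing Implicit Defensive.

(* The field sg_inhab reflects the convention that the empty graph is not a
   graph. *)
Record sgraph := SGraph {
  vertex :> finType;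
  adj : rel vertex;
  adj_sym : symmetric adj;
  adj_irr : irreflexive adj;
  sg_inhab : 0 < #|vertex|
}.

Definition edges (G : sgraph) : {set {set G}} :=
  [set E : {set G} | [exists x, exists y, adj x y && (E == [set x; y])]].

(* The edge set of the subgraph induced by I.  It is defined without building
   the induced subgraph, so that I may be empty. *)
Definition induced_edges (G : sgraph) (I : {set G}) : {set {set G}} :=
  [set E in edges G | E \subset I].

Definition sigma1 (G : sgraph) : nat :=
  #|[set I : {set G} | #|induced_edges I| == 1]|.

Definition connected_graph (G : sgraph) : Prop :=
  forall x y : G, connect (@adj G) x y.

(* ucycle also holds of [::], and of [:: x; y] when x and y are adjacent; only
   closed walks without repetition of length at least 3 are graph cycles. *)
Definition acyclic_graph (G : sgraph) : Prop :=
  ~ exists2 c : seq G, 2 < size c & ucycle (@adj G) c.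

Definition is_tree (G : sgraph) : Prop := connected_graph G /\ acyclic_graph G.

Definition graph_iso (G H : sgraph) : Prop :=
  exists2 f : G -> H, bijective f & forall x y, adj (f x) (f y) = adj x y.

(* The star K_{1,m}: m.+1 vertices, with centre ord0.  Two vertices are
   adjacent iff exactly one of them is the centre. *)
Definition star_rel (m : nat) : rel 'I_m.+1 :=
  fun i j => (i == ord0) != (j == ord0).

Lemma star_sym m : symmetric (@star_rel m).
Proof. by move=> i j; rewrite /star_rel eq_sym. Qed.

Lemma star_irr m : irreflexive (@star_rel m).
Proof. by move=> i; rewrite /star_rel eqxx. Qed.

Lemma star_inhab m : 0 < #|'I_m.+1|.
Proof. by rewrite card_ord. Qed.

Definition star (m : nat) : sgraph :=
  SGraph (@star_sym m) (@star_irr m) (star_inhab m).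

(* Main.v *)
(* Every edge, viewed as a pair of vertices, is a vertex subset inducing exactly
   one edge, and a connected graph has at least n - 1 edges; this gives the
   bound.  In case of equality the edges are the only such subsets, so for each
   edge xy and each further vertex z the set {x, y, z} induces another edge:
   every edge is dominating.  In a graph without triangles and 4-cycles this
   forces one vertex to be adjacent to all the others. *)
Require Import Defs.
From mathcomp Require Import all_boot perm.
Set Implicit Arguments.
Unset Strict Implicit.
Unset Printing Implicit Defensive.

(** Boolean [!=] is exclusive or, as in [star_rel]: this says that the graph is a star around [c],
    and it covers the one-vertex graph too. *)
Definition center (G : sgraph) (c : G) : Prop :=
  forall x y : G, adj x y = ((x == c) != (y == c)).

Lemma edgesP (G : sgraph) (E : {set G}) :
  reflect (exists x y : G, adj x y /\ E = [set x; y]) (E \in edges G).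
Proof.
rewrite inE; apply: (iffP existsP) => [[x /existsP[y /andP[xy /eqP ->]]]|].
  by exists x, y.
by case=> x [y [xy ->]]; exists x; apply/existsP; exists y; rewrite xy eqxx.
Qed.

Lemma adj_edge (G : sgraph) (x y : G) : adj x y -> [set x; y] \in edges G.
Proof. by move=> xy; apply/edgesP; exists x, y. Qed.

Lemma adj_neq (G : sgraph) (x y : G) : adj x y -> x != y.
Proof. by apply: contraTneq => ->; rewrite adj_irr. Qed.

Lemma card_edge (G : sgraph) (E : {set G}) : E \in edges G -> #|E| = 2.
Proof. by case/edgesP=> x [y [/adj_neq xy ->]]; rewrite cards2 xy. Qed.

Lemma induced_edges_edge (G : sgraph) (E : {set G}) :
  E \in edges G -> induced_edges E = [set E].
Proof.
move=> GE; apply/setP=> F; rewrite in_set1 inE; apply/andP/eqP => [[GF sFE]|->]; last by split.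
by apply/eqP; rewrite eqEcard sFE (card_edge GE) (card_edge GF).
Qed.

Lemma edges_sub_one_edge (G : sgraph) :
  edges G \subset [set I : {set G} | #|induced_edges I| == 1].
Proof. by apply/subsetP=> E GE; rewrite inE induced_edges_edge ?cards1. Qed.

Lemma leq_edges_sigma1 (G : sgraph) : #|edges G| <= sigma1 G.
Proof. exact/subset_leq_card/edges_sub_one_edge. Qed.

(** If no edge left [S], then [S] would be closed under adjacency and connectivity would carry [r]
    to every vertex. *)
Lemma connected_cut_edge (G : sgraph) (S : {set G}) (r : G) :
  connected_graph G -> r \in S -> S != setT ->
  exists x y : G, [/\ x \in S, y \notin S & adj x y].
Proof.
move=> conG rS /eqP ST.
case: (boolP [exists x in S, exists y in ~: S, adj x y]).
  case/exists_inP=> x xS /exists_inP[y]; rewrite inE => yS xy.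
  by exists x, y.
rewrite negb_exists_in => /forall_inP no_edge; case: ST; apply/setP=> z.
have out x y : x \in S -> adj x y -> y \in S.
  move=> xS xy; apply: contraR (no_edge x xS) => yS.
  by apply/exists_inP; exists y; rewrite ?inE.
have clS : closed (@adj G) (mem S).
  move=> x y xy; apply/idP/idP => [xS|yS]; first exact: out xS xy.
  by apply: out yS _; rewrite adj_sym.
by rewrite inE -(closed_connect clS (conG r z)).
Qed.

(* Take S of maximal order among the nonempty vertex sets inducing at least
   |S| - 1 edges: adding to S the outer end of an edge leaving S would
   contradict maximality, so S is everything. *)
Lemma connected_leq_edges (G : sgraph) :
  connected_graph G -> #|G| - 1 <= #|edges G|.
Proof.
move=> conG; case/card_gt0P: (sg_inhab G) => r _.
pose P (S : {set G}) := (r \in S) && (#|S| <= #|induced_edges S|.+1).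
have P1 : P [set r] by rewrite /P set11 cards1.
case: (@arg_maxnP _ [set r] P (fun S => #|S|) P1) => S /andP[rS leS] maxS.
have [ST|/(connected_cut_edge conG rS)] := eqVneq S setT.
  rewrite leq_subLR add1n -cardsT -ST; apply: leq_trans leS _.
  by rewrite ltnS subset_leq_card //; apply/subsetP=> E; rewrite inE => /andP[].
case=> x [y [xS yS xy]].
suff /maxS : P (y |: S) by rewrite /= cardsU1 yS add1n ltnn.
rewrite /P in_setU1 rS orbT cardsU1 yS add1n ltnS /=; apply: leq_trans leS _.
apply: proper_card; apply/properP; split.
  apply/subsetP=> E; rewrite !inE => /andP[-> sES] /=.
  exact: subset_trans sES (subsetUr _ _).
exists [set x; y].
  by rewrite inE adj_edge // subUset !sub1set !inE xS eqxx orbT.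
by rewrite inE subUset !sub1set (negbTE yS) !andbF.
Qed.

Lemma acyclic_triangle (G : sgraph) (x y z : G) :
  acyclic_graph G -> adj x y -> adj y z -> adj z x -> False.
Proof.
move=> acG xy yz zx; apply: acG; exists [:: x; y; z] => //.
rewrite /ucycle /= xy yz zx /= !inE negb_or.
by rewrite (adj_neq xy) (adj_neq yz) eq_sym (adj_neq zx).
Qed.

Lemma acyclic_square (G : sgraph) (x y z w : G) : acyclic_graph G ->
  x != z -> y != w -> adj x y -> adj y z -> adj z w -> adj w x -> False.
Proof.
move=> acG xz yw xy yz zw wx; apply: acG; exists [:: x; y; z; w] => //.
rewrite /ucycle /= xy yz zw wx /= !inE !negb_or xz yw.
by rewrite (adj_neq xy) (adj_neq yz) (adj_neq zw) eq_sym (adj_neq wx).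
Qed.

(** Otherwise [xy] would be the only edge inside the three-element set [{x, y, z}], which by
    hypothesis would itself be an edge, of size 2. *)
Lemma one_edge_sets_dominating (G : sgraph) (x y z : G) :
  [set I : {set G} | #|induced_edges I| == 1] \subset edges G ->
  adj x y -> z != x -> z != y -> adj x z || adj y z.
Proof.
move=> /subsetP one xy zx zy; apply: contraT; rewrite negb_or.
case/andP=> nxz nyz.
have /one /card_edge :
    z |: [set x; y] \in [set I : {set G} | #|induced_edges I| == 1].
  rewrite inE; suff -> : induced_edges (z |: [set x; y]) = [set [set x; y]].
    by rewrite cards1.
  apply/setP=> E; rewrite [RHS]inE inE; apply/andP/eqP => [[]|->]; last first.
    by rewrite adj_edge // subsetUr.
  case/edgesP=> a [b [ab ->]]; rewrite subUset !sub1set !inE.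
  (* Of the nine choices of endpoints, loops and pairs containing [z] are impossible; [xy] and [yx]
     remain. *)
  case/andP=> /or3P[] /eqP ea /or3P[] /eqP eb; move: ab; rewrite ea eb ?adj_irr //;
    try by rewrite ?(negbTE nxz) ?(negbTE nyz) // adj_sym
         ?(negbTE nxz) ?(negbTE nyz).
  by rewrite setUC.
by rewrite cardsU1 cards2 (adj_neq xy) !inE (negbTE zx) (negbTE zy).
Qed.

Lemma acyclic_universal_center (G : sgraph) (c : G) : acyclic_graph G ->
  (forall w, w != c -> adj c w) -> center c.
Proof.
move=> acG univ x y.
have [->|xc] := eqVneq x c; have [->|yc] := eqVneq y c.
- by rewrite adj_irr.
- by rewrite univ.
- by rewrite adj_sym univ.
apply/negP=> xy; apply: (acyclic_triangle acG (univ x xc) xy).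
by rewrite adj_sym univ.
Qed.

Lemma dominating_edges_center (G : sgraph) : is_tree G ->
  (forall x y z : G, adj x y -> z != x -> z != y -> adj x z || adj y z) ->
  exists c : G, center c.
Proof.
case=> conG acG dom; case/card_gt0P: (sg_inhab G) => r _.
suff [c univ] : exists c : G, forall w, w != c -> adj c w.
  by exists c; apply: acyclic_universal_center.
(* A one-vertex graph has no edge to start from, so it is treated apart. *)
have [Gr|nGr] := eqVneq [set r] setT.
  by exists r => w; have := in_setT w; rewrite -Gr inE => ->.
have [x [y [_ _ xy]]] := connected_cut_edge conG (set11 r) nGr.
(* If [x] has a second neighbour [z], then [x] is the centre: a vertex [w] not adjacent to [x] would
   be adjacent to [y] and to [z], closing the 4-cycle [x y w z]. If not, domination by [xy] makes
   [y] the centre. *)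
case: (pickP (fun z => adj x z && (z != y))) => [z /andP[xz zy]|only_y].
  exists x => w wx; have [->//|wy] := eqVneq w y.
  case/orP: (dom x y w xy wx wy) => // yw.
  have [->//|wz] := eqVneq w z.
  case/orP: (dom x z w xz wx wz) => // zw; exfalso.
  by apply: (@acyclic_square _ x y w z acG); rewrite // 1?eq_sym // adj_sym.
exists y => w wy; have [->|wx] := eqVneq w x; first by rewrite adj_sym.
by case/orP: (dom x y w xy wx wy) => // xw; have := only_y w; rewrite xw wy.
Qed.

Lemma center_edge (G : sgraph) (c : G) (E : {set G}) :
  center c -> E \in edges G -> exists2 v, v != c & E = [set c; v].
Proof.
move=> cP /edgesP[x [y [xy ->]]]; move: xy; rewrite cP.
have [->|xc] := eqVneq x c; have [->|yc] := eqVneq y c => // _.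
  by exists y.
by exists x => //; rewrite setUC.
Qed.

(** A set inducing a single edge [{c, v}] contains [c], so any further member [w] would add the edge
    [{c, w}]. Hence the set is [{c, v}], and [v] ranges over the vertices other than [c]. *)
Lemma center_leq_sigma1 (G : sgraph) (c : G) :
  center c -> sigma1 G <= #|G| - 1.
Proof.
move=> cP; have -> : #|G| - 1 = #|[set~ c]| by rewrite cardsC1 subn1.
apply: leq_trans (leq_imset_card (fun v => [set c; v]) _).
apply/subset_leq_card/subsetP=> I; rewrite inE => /cards1P[E IE].
have : E \in induced_edges I by rewrite IE set11.
rewrite inE => /andP[/(center_edge cP)[v vc defE] sEI].
have [cI vI] : c \in I /\ v \in I.
  by split; apply: (subsetP sEI); rewrite defE !inE eqxx ?orbT.
apply/imsetP; exists v; first by rewrite !inE.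
apply/eqP; rewrite eqEsubset -{2}defE sEI andbT; apply/subsetP=> w wI.
rewrite !inE; have [//|wc /=] := eqVneq w c.
have : [set c; w] \in induced_edges I.
  by rewrite inE adj_edge ?cP ?eqxx ?(negbTE wc) // subUset !sub1set cI.
rewrite IE defE in_set1 => /eqP/setP/(_ w).
by rewrite !inE eqxx orbT (negbTE wc) => /= <-.
Qed.

Lemma graph_iso_starP (G : sgraph) :
  graph_iso G (star (#|G| - 1)) <-> exists c : G, center c.
Proof.
have n_gt0 : #|G| = (#|G| - 1).+1 by rewrite subn1 prednK ?sg_inhab.
split=> [[f [g fK gK] fE]|[c cP]].
  by exists (g ord0) => x y; rewrite -fE -!(can2_eq fK gK).
pose h (x : G) := cast_ord n_gt0 (enum_rank x).
have h_bij : bijective h.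
  exists (fun i => enum_val (cast_ord (esym n_gt0) i)) => x.
    by rewrite /h cast_ordK enum_rankK.
  by rewrite /h enum_valK cast_ordKV.
(* The numbering [h] is arbitrary; the transposition moves the number of [c] to [ord0]. *)
exists (tperm (h c) ord0 \o h).
  by apply: bij_comp h_bij; exists (tperm (h c) ord0); apply: tpermK.
have f0 x : (tperm (h c) ord0 (h x) == ord0) = (x == c).
  by rewrite -[X in _ == X](tpermL (h c)) (inj_eq perm_inj) (bij_eq h_bij).
by move=> x y; rewrite cP /= /star_rel !f0.
Qed.

Theorem corollary2 (n : nat) (T : sgraph) (treeT : is_tree T) (orderT : #|T| = n) :
  n - 1 <= sigma1 T /\ (sigma1 T = n - 1 <-> graph_iso T (star (n - 1))).
Proof.
rewrite -orderT; have [conT _] := treeT.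
have le_edges := connected_leq_edges conT.
have le_sigma1 := leq_trans le_edges (leq_edges_sigma1 T).
split=> //; split=> [eq_sigma1|/graph_iso_starP[c /center_leq_sigma1 ge_sigma1]].
  apply/graph_iso_starP; apply: dominating_edges_center treeT _ => x y z.
  apply: one_edge_sets_dominating.
  (* The edges are among the sets counted by [sigma1] and number at least [#|T| - 1], so equality
     leaves no other such set. *)
  have /eqP <- // : edges T == [set I : {set T} | #|induced_edges I| == 1].
  by rewrite eqEcard edges_sub_one_edge -/(sigma1 T) eq_sigma1.
by apply/eqP; rewrite eqn_leq ge_sigma1.
Qed.
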